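(* Let $G=(V,E)$ be a strongly connected directed graph on a countable node set and let $i,j\in V$ be distinct. Nodes $i$ and $j$ are joint-ancestor free if and only if there exists an $i,j$-sourced cut of $G$. In this case, the only $i,j$-sourced cut is $(A_i(G\setminus j),A_j(G\setminus i))$.
   Context: $E\subseteq V\times V$ (self-loops allowed). A path is a sequence $v_1,\dots,v_n$ ($n\ge1$) of distinct nodes with $(v_p,v_{p+1})\in E$ for all $p<n$; $n=1$ is allowed. $G$ is strongly connected if there is a path from every node to every node. $G\setminus u$ is the subgraph obtained by deleting node $u$ and all its incident edges. $A_i(H)$ denotes the set of all nodes from which there is a path to $i$ in $H$ (so $i\in A_i(H)$). Nodes $i\ne j$ are joint-ancestor free if $A_i(G\setminus j)\cap A_j(G\setminus i)=\emptyset$. A cut of $G$ is a pair $(A,B)$ of nonempty sets with $A\cup B=V$ and $A\cap B=\emptyset$. Its source is the pair $(I,J)$ with $I=\{u\in A:E\cap(\{u\}\times B)\neq\emptyset\}$ and $J=\{u\in B:E\cap(\{u\}\times A)\neq\emptyset\}$. An $i,j$-sourced cut is a cut whose source is $(\{i\},\{j\})$. *)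

(* Defs.v *)
From mathcomp Require Import all_boot.
From mathcomp Require Import boolp classical_sets cardinality.

Set Implicit Arguments.
Unset Strict Implicit.
Unset Printing Implicit Defensive.

Local Open Scope classical_set_scope.

(* The node set is a subset of an ambient type, so that a graph and its
   node-deleted subgraphs have the same type. *)
Record digraph (T : Type) := Digraph {
  nodes : set T;
  edges : set (T * T);
  edges_sub : edges `<=` nodes `*` nodes
}.

Lemma delete_node_sub (T : Type) (G : digraph T) (u : T) :
  edges G `&` (~` [set u] `*` ~` [set u])
    `<=` (nodes G `\ u) `*` (nodes G `\ u).
Proof.
by move=> e [/edges_sub[Ge1 Ge2] [e1u e2u]].
Qed.

Definition delete_node (T : Type) (G : digraph T) (u : T) : digraph T :=
  Digraph (@delete_node_sub T G u).

Definition is_path (T : eqType) (G : digraph T) (s : seq T) : Prop :=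
  [/\ s != [::],
      (forall v, v \in s -> nodes G v),
      uniq s &
      sorted (fun u v => `[< edges G (u, v) >]) s].

Definition has_path (T : eqType) (G : digraph T) (u v : T) : Prop :=
  exists p : seq T, is_path G (u :: p) /\ last u p = v.

Definition strongly_connected (T : eqType) (G : digraph T) : Prop :=
  forall u v, nodes G u -> nodes G v -> has_path G u v.

Definition ancestors (T : eqType) (G : digraph T) (i : T) : set T :=
  [set u | has_path G u i].

(* Meant for distinct nodes i and j of G. *)
Definition joint_ancestor_free (T : eqType) (G : digraph T) (i j : T) : Prop :=
  ancestors (delete_node G j) i `&` ancestors (delete_node G i) j = set0.

Definition is_cut (T : Type) (G : digraph T) (C : set T * set T) : Prop :=
  [/\ C.1 !=set0, C.2 !=set0, C.1 `|` C.2 = nodes G & C.1 `&` C.2 = set0].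

Definition cut_source (T : Type) (G : digraph T) (C : set T * set T) :
    set T * set T :=
  ([set u | C.1 u /\ edges G `&` ([set u] `*` C.2) !=set0],
   [set u | C.2 u /\ edges G `&` ([set u] `*` C.1) !=set0]).

Definition sourced_cut (T : Type) (G : digraph T) (i j : T)
    (C : set T * set T) : Prop :=
  is_cut G C /\ cut_source G C = ([set i], [set j]).

(* Main.v *)
Require Import Defs.
From mathcomp Require Import all_boot.
From mathcomp Require Import boolp classical_sets cardinality.

Set Implicit Arguments.
Unset Strict Implicit.
Unset Printing Implicit Defensive.

Local Open Scope classical_set_scope.

(** Reachability of a fixed node [v] is the least property of nodes that holds
    at [v] and passes from the head of an edge to its tail: this is
    [ancestors_edge] and [has_path_ind].  Write [A] for the ancestors of [i]
    off [j], and [B] for the ancestors of [j] off [i].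

    - The sets [A] and [B] always cover a strongly connected graph.  Their
      union is closed under stepping backwards along an edge: the only tail
      that can drop out of [A] is [j], which is in [B], and vice versa.  Since
      the union contains [i], which everything reaches, it is everything.
    - If [A] and [B] are disjoint, they form a cut.  An edge from [u] in [A] to
      [B] forces [u = i], as otherwise the edge survives the deletion of [i] and
      puts [u] in [B].  Such an edge exists, since otherwise nothing in [A]
      would reach [j].  So the source is [({i}, {j})].
    - Conversely, the only way from the second side of an [i,j]-sourced cut to
      the first is through [j], so [A] lies in the first side; symmetrically
      [B] lies in the second.  Hence [A] and [B] are disjoint, and as they cover
      the graph, both inclusions are equalities: the cut is [(A, B)]. *)

(** Cutting the loops out of a walk leaves a path. *)
Lemma has_path_walk (T : eqType) (H : digraph T) (u : T) (p : seq T) :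
  nodes H u -> path (fun x y => `[< edges H (x, y) >]) u p ->
  has_path H u (last u p).
Proof.
move=> Hu /shortenP[q eq Uq _]; exists q; split=> //; split=> //.
elim: q u Hu eq {Uq} => [|y q IHq] x Hx /= => [_ v|/andP[/asboolP exy eq] v].
  by rewrite inE => /eqP->.
by rewrite inE => /predU1P[->//|]; apply: IHq eq v; have [] := edges_sub exy.
Qed.

Lemma ancestors_edge (T : eqType) (H : digraph T) (v x y : T) :
  edges H (x, y) -> ancestors H v y -> ancestors H v x.
Proof.
move=> exy [p [[_ _ _ /= ep] <-]]; have [Hx _] := edges_sub exy.
by apply: (@has_path_walk _ H x (y :: p)) => //=; rewrite ep andbT; apply/asboolP.
Qed.

Lemma ancestors_refl (T : eqType) (H : digraph T) (v : T) :
  nodes H v -> ancestors H v v.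
Proof. by move=> Hv; apply: (@has_path_walk _ H v [::]). Qed.

Lemma ancestors_nodes (T : eqType) (H : digraph T) (v : T) :
  ancestors H v `<=` nodes H.
Proof. by move=> u [p [[_ Hp _ _] _]]; apply: Hp; rewrite mem_head. Qed.

(** Backward induction along a path. *)
Lemma has_path_ind (T : eqType) (H : digraph T) (P : set T) (u v : T) :
  (forall x y, edges H (x, y) -> P y -> P x) ->
  has_path H u v -> P v -> P u.
Proof.
move=> PH [p [[_ _ _ /= ep] <-]].
elim: p u ep => //= y p IHp x /andP[/asboolP exy ep] Pv.
exact: PH exy (IHp _ ep Pv).
Qed.

Lemma delete_node_edge (T : eqType) (G : digraph T) (j x y : T) :
  edges G (x, y) -> x <> j -> y <> j -> edges (delete_node G j) (x, y).
Proof. by []. Qed.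

Section TwoNodes.
Variables (T : eqType) (G : digraph T).
Hypothesis G_strong : strongly_connected G.

Implicit Types (i j u : T) (A B : set T).

Local Notation anc i j := (ancestors (delete_node G j) i).

Lemma ancestors_delete_refl i j : nodes G i -> i <> j -> anc i j i.
Proof. by move=> Gi neq; apply: ancestors_refl. Qed.

(** The step that makes the two ancestor sets cover the graph: [j] is the only
    tail at which membership in the first set can be lost. *)
Lemma ancestors_delete_edge i j x y :
  nodes G j -> i <> j -> edges G (x, y) -> anc i j y -> anc i j x \/ anc j i x.
Proof.
move=> Gj neq exy ay; have [-> | /eqP xj] := eqVneq x j.
  by right; apply: ancestors_delete_refl => // /esym.
have [_ yj] := ancestors_nodes ay.
by left; apply: ancestors_edge ay; apply: delete_node_edge.
Qed.

Lemma ancestors_delete_cover i j :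
  nodes G i -> nodes G j -> i <> j -> anc i j `|` anc j i = nodes G.
Proof.
move=> Gi Gj neq; apply/seteqP; split=> u.
  by case=> /ancestors_nodes[].
move=> Gu; apply: (has_path_ind _ (G_strong Gu Gi)); last first.
  by left; apply: ancestors_delete_refl.
move=> x y exy [|] ay; first exact: ancestors_delete_edge exy ay.
by apply/or_comm/(ancestors_delete_edge Gi _ exy ay) => /esym.
Qed.

Lemma joint_ancestor_free_sym i j :
  joint_ancestor_free G i j -> joint_ancestor_free G j i.
Proof. by rewrite /joint_ancestor_free setIC. Qed.

Lemma joint_ancestor_free_exit i j :
    nodes G i -> nodes G j -> i <> j -> joint_ancestor_free G i j ->
  [set u | anc i j u /\ edges G `&` ([set u] `*` anc j i) !=set0] = [set i].
Proof.
move=> Gi Gj neq free.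
have dis u : anc i j u -> anc j i u -> False.
  by move=> Au Bu; have : set0 u by rewrite -free.
have ii : anc i j i by apply: ancestors_delete_refl.
have exit x y : edges G (x, y) -> anc i j x -> anc j i y -> x = i.
  move=> exy ax ay; apply: contrapT => xi; apply: (dis _ ax).
  have [_ yi] := ancestors_nodes ay.
  by apply: ancestors_edge ay; apply: delete_node_edge.
apply/seteqP; split=> [u [au [[x y] [exy [/= xu ay]]]]|u ->].
  by rewrite xu in exy; apply: exit exy au ay.
split=> //; apply: contrapT => no_exit; apply: (dis i) => //.
(* Without an edge from [i] to the ancestors of [j], these would be closed
   under stepping backwards, and so contain [i]. *)
apply: (has_path_ind _ (G_strong Gi Gj)); last first.
  by apply: ancestors_delete_refl => // /esym.
move=> x y exy ay.
have : (anc i j `|` anc j i) x.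
  by rewrite ancestors_delete_cover //; have [] := edges_sub exy.
case=> // ax; case: no_exit; exists (x, y).
by split=> //; split=> //=; apply: exit exy ax ay.
Qed.

Lemma joint_ancestor_free_cut i j :
    nodes G i -> nodes G j -> i <> j -> joint_ancestor_free G i j ->
  sourced_cut G i j (anc i j, anc j i).
Proof.
move=> Gi Gj neq free; have neq' : j <> i by move/esym.
split.
  split=> //=; first by exists i; apply: ancestors_delete_refl.
    by exists j; apply: ancestors_delete_refl.
  exact: ancestors_delete_cover.
rewrite /cut_source /= joint_ancestor_free_exit // joint_ancestor_free_exit //.
exact: joint_ancestor_free_sym.
Qed.

Lemma sourced_cut_sym i j A B :
  sourced_cut G i j (A, B) -> sourced_cut G j i (B, A).
Proof.
case=> -[/= A0 B0 AUB AIB] [srcA srcB]; split; last by rewrite /cut_source /= srcA srcB.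
by split=> //=; rewrite (setUC, setIC).
Qed.

(** A path that avoids [j] cannot leave the second side of the cut, so what
    reaches [i] off [j] starts in the first side. *)
Lemma sourced_cut_ancestors i j A B :
  sourced_cut G i j (A, B) -> anc i j `<=` A.
Proof.
case=> -[/= _ _ AUB _] [srcA srcB] u pu.
apply: (has_path_ind _ pu) => [x y [exy [/= xj _]] Ay|].
  have : (A `|` B) x by rewrite AUB; have [] := edges_sub exy.
  case=> // Bx; case: xj.
  suff : [set j] x by [].
  by rewrite -srcB; split=> //; exists (x, y).
by have : [set i] i by []; rewrite -srcA => -[].
Qed.

Lemma sourced_cut_joint_ancestor_free i j A B :
  sourced_cut G i j (A, B) -> joint_ancestor_free G i j.
Proof.
move=> cut; have [[_ _ _ /= AIB] _] := cut.
rewrite /joint_ancestor_free -subset0 -AIB; apply: setISS; first exact: sourced_cut_ancestors cut.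
exact: sourced_cut_ancestors (sourced_cut_sym cut).
Qed.

(** The ancestor sets cover the graph and the second one lies in the second
    side, so a node of the first side is left with the first ancestor set. *)
Lemma sourced_cut_side i j A B :
    nodes G i -> nodes G j -> i <> j -> sourced_cut G i j (A, B) ->
  A = anc i j.
Proof.
move=> Gi Gj neq cut; have [[_ _ /= AUB AIB] _] := cut.
apply/seteqP; split; last exact: sourced_cut_ancestors cut.
move=> u Au; have : (anc i j `|` anc j i) u.
  by rewrite ancestors_delete_cover // -AUB; left.
case=> // /(sourced_cut_ancestors (sourced_cut_sym cut)) Bu.
by have : set0 u by rewrite -AIB.
Qed.

End TwoNodes.

Theorem proposition18 (T : eqType) (G : digraph T) (i j : T)
  (countable_nodes : countable (nodes G))
  (G_strong : strongly_connected G)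
  (Gi : nodes G i) (Gj : nodes G j) (neq_ij : i <> j) :
  (joint_ancestor_free G i j <-> exists C : set T * set T, sourced_cut G i j C)
  /\
  (joint_ancestor_free G i j ->
   forall C : set T * set T,
     sourced_cut G i j C <->
     C = (ancestors (delete_node G j) i, ancestors (delete_node G i) j)).
Proof.
split; first split=> [free|[[A B] cut]].
- by eexists; apply: joint_ancestor_free_cut free.
- exact: sourced_cut_joint_ancestor_free cut.
move=> free [A B]; split=> [cut|->]; last exact: joint_ancestor_free_cut.
rewrite (sourced_cut_side G_strong Gi Gj neq_ij cut).
by rewrite (sourced_cut_side G_strong Gj Gi (nesym neq_ij) (sourced_cut_sym cut)).
Qed.
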